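(* Let $f(y)=\pi-\arccos y$ and $I=|\dot\phi|\,f(y)$. Fix constants $0<a\le A$, $c>0$ and $K>0$. Then there exist $\delta_0>0$ and $C>0$ (depending only on $a,A,c,K$) such that the following holds for every $\delta\in(0,\delta_0)$. Let the dumbbell have mass ratio $\beta_1=\epsilon=\delta^2$. Consider consecutive collisions with the floor, numbered $0,1,\dots,N$ with $N\le K/\delta$, all made by the light mass $m_1$ (with no collision of $m_2$ in between). Let $y_n,\phi_n$ be the values of $y,\phi$ at collision number $n$, and let $\dot\phi_n,\dot y_n$ be the velocities immediately before it. Suppose that $a\le|\dot\phi_0|\le A$ (so $\dot\phi_0\ne 0$), that $|\phi_n-\tfrac{3\pi}{2}|\ge c$ (so $\phi_n\neq\tfrac{3\pi}{2}$) at each of these collisions, and that $-\delta<\dot y_0<0$. Then $I$ is an adiabatic invariant, i.e. $$\bigl|\,|\dot\phi_N|\,f(y_N)-|\dot\phi_0|\,f(y_0)\,\bigr|\le C\,\delta .$$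
   Context: A dumbbell consists of two point masses $m_1,m_2>0$ joined by a weightless rigid rod of length $1$, moving in the plane above the floor $\{y=0\}$ with no external forces. Let $\beta_1=\frac{m_1}{m_1+m_2}$, $\beta_2=\frac{m_2}{m_1+m_2}=1-\beta_1$, $m=m_1+m_2$. Let $y$ be the height of the center of mass and $\phi$ the angle (mod $2\pi$, counterclockwise from the horizontal) of the rod, so that the heights of the masses are $y_1=y+\beta_2\sin\phi\ge 0$ and $y_2=y-\beta_1\sin\phi\ge 0$ (here the subscripts in $y_1,y_2$ refer to the masses, whereas in the claim the subscript $n$ in $y_n$ is a collision index). The horizontal velocity of the center of mass is constant and is taken to be $0$. Between collisions $\dot y$ and $\dot\phi$ are constant. The kinetic energy is $\frac12 m\dot y^2+\frac12\beta_1\beta_2 m\dot\phi^2$. Collisions are elastic: with $Y=y/\sqrt{\beta_1\beta_2}$, the point $(Y,\phi)$ moves as a billiard particle with specular reflection (in the Euclidean metric) at the boundary of the allowed region $Y\ge\max\{-\sqrt{\beta_2/\beta_1}\sin\phi,\ \sqrt{\beta_1/\beta_2}\sin\phi\}$. Explicitly, when $m_1$ hits the floor at angle $\phi$, the velocities $(\dot y_-,\dot\phi_-)$ before and $(\dot y_+,\dot\phi_+)$ after are related by $$\dot y_+=\dot y_-\Bigl(-1+\tfrac{2\beta_2\cos^2\phi}{\beta_1+\beta_2\cos^2\phi}\Bigr)-\dot\phi_-\tfrac{2\beta_1\beta_2\cos\phi}{\beta_1+\beta_2\cos^2\phi},\qquad \dot\phi_+=\dot\phi_-\Bigl(1-\tfrac{2\beta_2\cos^2\phi}{\beta_1+\beta_2\cos^2\phi}\Bigr)-\dot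 y_-\tfrac{2\cos\phi}{\beta_1+\beta_2\cos^2\phi}.$$ The rule when $m_2$ hits is obtained by swapping $\beta_1,\beta_2$ and replacing $\cos\phi,\sin\phi$ by $-\cos\phi,-\sin\phi$. Simultaneous collisions of both masses with the floor are excluded. *)

(* Defs.v *)
From Stdlib Require Import Reals.
Open Scope R_scope.

Definition beta1 (m1 m2 : R) : R := m1 / (m1 + m2).
Definition beta2 (m1 m2 : R) : R := m2 / (m1 + m2).

Inductive mass := Mass1 | Mass2.

Definition other (i : mass) : mass :=
  match i with Mass1 => Mass2 | Mass2 => Mass1 end.

(* [y] is the height of the center of mass and [phi] a real lift of the angle
   of the rod, which makes [phi] a continuous function of time; everything
   below depends on [phi] only modulo [2 * PI]. *)
Definition height (m1 m2 : R) (i : mass) (y phi : R) : R :=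
  match i with
  | Mass1 => y + beta2 m1 m2 * sin phi
  | Mass2 => y - beta1 m1 m2 * sin phi
  end.

(* Specular reflection when the mass with mass fraction [p] hits the floor;
   [q] is the other mass fraction, [k] is the cosine of the direction from the
   other mass to the colliding one, and [v], [w] are the values of dy/dt and
   dphi/dt before the collision. *)
Definition reflect_y (p q k v w : R) : R :=
  v * (-1 + 2 * q * k ^ 2 / (p + q * k ^ 2))
  - w * (2 * p * q * k / (p + q * k ^ 2)).

Definition reflect_phi (p q k v w : R) : R :=
  w * (1 - 2 * q * k ^ 2 / (p + q * k ^ 2))
  - v * (2 * k / (p + q * k ^ 2)).

Definition after_y (m1 m2 : R) (i : mass) (phi v w : R) : R :=
  match i with
  | Mass1 => reflect_y (beta1 m1 m2) (beta2 m1 m2) (cos phi) v w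
  | Mass2 => reflect_y (beta2 m1 m2) (beta1 m1 m2) (- cos phi) v w
  end.

Definition after_phi (m1 m2 : R) (i : mass) (phi v w : R) : R :=
  match i with
  | Mass1 => reflect_phi (beta1 m1 m2) (beta2 m1 m2) (cos phi) v w
  | Mass2 => reflect_phi (beta2 m1 m2) (beta1 m1 m2) (- cos phi) v w
  end.

(* Motion with constant velocities [v], [w] on [[s0, s1]], neither mass being
   on the floor strictly between the times [s0] and [s1]. *)
Definition free_flight (m1 m2 : R) (y phi : R -> R) (s0 s1 v w : R) : Prop :=
  s0 < s1 /\
  (forall s, s0 <= s <= s1 ->
     y s = y s0 + v * (s - s0) /\ phi s = phi s0 + w * (s - s0)) /\
  (forall s i, s0 < s < s1 -> 0 < height m1 m2 i (y s) (phi s)).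

(* The positivity of the other height excludes simultaneous collisions. *)
Definition collision (m1 m2 : R) (i : mass) (y phi : R) : Prop :=
  height m1 m2 i y phi = 0 /\ 0 < height m1 m2 (other i) y phi.

(* Along the motion [y], [phi] (functions of time), the collisions number
   0, ..., N occur at the times [t 0], ..., [t N]; collision number [n] is made
   by the mass [hit n], and [vy n], [vphi n] are the velocities immediately
   before it. *)
Definition consecutive_collisions (m1 m2 : R) (y phi : R -> R) (N : nat)
    (hit : nat -> mass) (t vy vphi : nat -> R) : Prop :=
  (exists s, free_flight m1 m2 y phi s (t 0%nat) (vy 0%nat) (vphi 0%nat)) /\
  (forall n, (n <= N)%nat ->
     collision m1 m2 (hit n) (y (t n)) (phi (t n))) /\
  (forall n, (n < N)%nat ->
     free_flight m1 m2 y phi (t n) (t (S n)) (vy (S n)) (vphi (S n)) /\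
     vy (S n) = after_y m1 m2 (hit n) (phi (t n)) (vy n) (vphi n) /\
     vphi (S n) = after_phi m1 m2 (hit n) (phi (t n)) (vy n) (vphi n)).

Definition f (y : R) : R := PI - acos y.

Definition action (y w : R) : R := Rabs w * f y.

(* Main.v *)
Require Import Defs.
From Stdlib Require Import Reals Lra Lia ZArith.
Open Scope R_scope.

(** Write [d] for [delta], so that the light mass has mass fraction [d ^ 2], and let
    [v], [w] be the velocities before a collision.

    The heavy end stays near the center of mass, so the light mass runs around a circle
    of radius about 1 whose center moves slowly: energy conservation together with
    [|v| <= d] initially gives [v = O(d)] and [w = O(1)] at every collision.  During a
    flight the light mass sweeps the arc of the circle above the floor, which has
    length about [2 * f y]; hence [y] changes by about [2 * v * f y / |w|].  At the
    collision, [|w|] changes by about [- 2 * v / |cos phi|], with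
    [|cos phi| = sqrt (1 - y ^ 2)] to leading order.  As [f' y = 1 / sqrt (1 - y ^ 2)],
    the two contributions to the change of [|w| * f y] cancel to first order in [d],
    and what is left is [O(d ^ 2)] per collision.  Over [K / d] collisions this adds up to
    [O(d)].

    To make this exact, [f y] is replaced by [PI / 2 + x], where the contact angle [x] is
    the angle in [(0, PI / 2)] between the rod and the floor.  The difference is [O(d ^ 2)]
    ([contact_action_close]), and the rotation during a flight becomes exactly
    [(PI / 2 + x) + (PI / 2 + x')] ([turn_of_flight]): neither another type of flight,
    such as a second hit on the same side of the vertical, nor an additional full
    revolution is possible when [d] is small.  The collision law is expanded in
    [reflect_y_small_mass] and [reflect_phi_small_mass], the cancellation is
    [action_step], and [contact_action_drift] puts these together for one collision and
    the flight after it.  This last estimate needs a lower bound on [|w|]; since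
    [PI / 2 + x] lies between [PI / 2] and [PI], the bound at collision [n] follows from
    the near-invariance up to collision [n], which closes the induction. *)

(** * Estimates for the sine *)

Lemma sin_mean_value : forall x y, exists z,
  sin y - sin x = cos z * (y - x) /\ Rmin x y <= z <= Rmax x y.
Proof.
  intros x y. destruct (Rtotal_order x y) as [H | [H | H]].
  - destruct (MVT_cor2 sin cos x y H) as [z [E I]].
    { intros; apply derivable_pt_lim_sin. }
    exists z. rewrite Rmin_left, Rmax_right by lra. split; [exact E | lra].
  - exists x. subst y. rewrite Rmin_left, Rmax_left by lra. split; lra.
  - destruct (MVT_cor2 sin cos y x H) as [z [E I]].
    { intros; apply derivable_pt_lim_sin. }
    exists z. rewrite Rmin_right, Rmax_left by lra. split; lra.
Qed.

Lemma cos_lipschitz : forall x y, Rabs (cos y - cos x) <= Rabs (y - x).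
Proof.
  assert (H : forall x y, x < y -> Rabs (cos y - cos x) <= Rabs (y - x)).
  { intros x y H.
    destruct (MVT_cor2 cos (fun z => - sin z) x y H) as [z [-> _]].
    { intros; apply derivable_pt_lim_cos. }
    rewrite Rabs_mult.
    assert (Rabs (- sin z) <= 1) by (apply Rabs_le; pose proof (SIN_bound z); lra).
    pose proof (Rabs_pos (y - x)). nra. }
  intros x y. destruct (Rtotal_order x y) as [G | [-> | G]].
  - now apply H.
  - rewrite !Rminus_diag. lra.
  - rewrite Rabs_minus_sym, (Rabs_minus_sym y x). now apply H.
Qed.

Lemma cos_between_ge : forall s x y z,
  0 <= x <= PI / 2 -> 0 <= y <= PI / 2 -> s <= cos x -> s <= cos y ->
  Rmin x y <= z <= Rmax x y -> s <= cos z.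
Proof.
  intros s x y z Hx Hy Cx Cy Hz. pose proof PI_RGT_0.
  destruct (Rle_dec x y) as [H1 | H1].
  - rewrite Rmin_left, Rmax_right in Hz by lra.
    apply Rle_trans with (cos y); [exact Cy | apply cos_decr_1; lra].
  - rewrite Rmin_right, Rmax_left in Hz by lra.
    apply Rle_trans with (cos x); [exact Cx | apply cos_decr_1; lra].
Qed.

(** Away from the vertical the height determines the angle in a Lipschitz way. *)
Lemma sin_expanding : forall s x y,
  0 <= x <= PI / 2 -> 0 <= y <= PI / 2 -> 0 <= s -> s <= cos x -> s <= cos y ->
  s * Rabs (y - x) <= Rabs (sin y - sin x).
Proof.
  intros s x y Hx Hy Hs Cx Cy.
  destruct (sin_mean_value x y) as [z [-> Hz]].
  pose proof (cos_between_ge s x y z Hx Hy Cx Cy Hz).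
  rewrite Rabs_mult, (Rabs_pos_eq (cos z)) by lra.
  pose proof (Rabs_pos (y - x)). nra.
Qed.

Lemma sin_taylor : forall x y,
  Rabs (sin y - sin x - cos x * (y - x)) <= Rabs (y - x) ^ 2.
Proof.
  intros x y. destruct (sin_mean_value x y) as [z [-> Hz]].
  replace (cos z * (y - x) - cos x * (y - x)) with ((cos z - cos x) * (y - x)) by ring.
  rewrite Rabs_mult. pose proof (cos_lipschitz x z) as H.
  assert (Rabs (z - x) <= Rabs (y - x)).
  { revert Hz. unfold Rmin, Rmax.
    destruct (Rle_dec x y); intros; unfold Rabs; repeat destruct Rcase_abs; lra. }
  pose proof (Rabs_pos (y - x)). nra.
Qed.

(** * The flight of the light mass *)

Lemma derivative_ge_0_of_positive_after : forall h d T,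
  derivable_pt_lim h 0 d -> h 0 = 0 -> 0 < T ->
  (forall r, 0 < r < T -> 0 < h r) -> 0 <= d.
Proof.
  intros h d T Hd H0 HT Hp. destruct (Rle_dec 0 d) as [|Hn]; [assumption | exfalso].
  destruct (Hd (- d)) as [e He]; [lra |]. pose proof (cond_pos e).
  set (r := Rmin (e / 2) (T / 2)).
  assert (Hr : 0 < r) by (apply Rmin_pos; lra).
  assert (r <= e / 2) by apply Rmin_l. assert (r <= T / 2) by apply Rmin_r.
  specialize (He r). rewrite Rplus_0_l, H0, Rminus_0_r in He.
  assert (Hq : Rabs (h r / r - d) < - d).
  { apply He; [lra | rewrite Rabs_pos_eq; lra]. }
  apply Rabs_def2 in Hq.
  assert (0 < h r / r) by (apply Rdiv_lt_0_compat; [apply Hp; lra | lra]). lra.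
Qed.

(** Here [x] and [x'] are the contact angles at the two ends of a flight, [q * sin x] is the
    initial height of the center of mass, [v] its velocity, and [u] the angular velocity,
    with the sign for which the light mass is at angle [- x] at the start.  The light mass
    must leave the floor, and as [v] is small this forces [u > 0].  It cannot reach the
    downward vertical, where it would be under the floor, so it makes less than one
    revolution.  It cannot land on the side it started from, because there its height
    over the center of mass increases at a rate of at least [s * L / 2], which is faster
    than the center of mass can fall.  It therefore lands on the other side, at angle
    [PI + x']. *)
Lemma turn_of_flight : forall s L eta q v u T x x',
  0 < s -> 0 < L -> 1 / 2 <= q <= 1 -> 8 * PI * eta < s ^ 2 * L ->
  Rabs v <= eta -> L <= Rabs u -> 0 < T ->
  0 < x < PI / 2 -> s <= cos x -> 0 < x' < PI / 2 ->
  (forall r, 0 < r < T -> 0 < q * sin x + v * r + q * sin (u * r - x)) ->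
  q * sin x + v * T + q * sin (u * T - x) = 0 ->
  sin (u * T - x) = - sin x' ->
  0 < u /\ u * T = PI + x + x'.
Proof.
  intros s L eta q v u T x x' Hs HL Hq Heta Hv Hu HT Hx Cx Hx' Hpos Hend Hsin.
  pose proof PI2_3_2 as HPI. pose proof (COS_bound x) as HC.
  assert (Hs1 : s <= 1) by lra.
  pose proof (Rabs_pos v).
  assert (Hv2 : - eta <= v <= eta) by (revert Hv; unfold Rabs; destruct Rcase_abs; lra).
  assert (Heta2 : 2 * eta < s * L).
  { assert (s ^ 2 * L <= s * L) by (replace (s ^ 2 * L) with (s * (s * L)) by ring;
      assert (0 < s * L) by nra; nra). nra. }
  assert (Hup : 0 < u).
  { assert (Hd : 0 <= v + q * (u * cos x)).
    { apply derivative_ge_0_of_positive_after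
        with (h := fun r => q * sin x + v * r + q * sin (u * r - x)) (T := T); auto.
      - replace (v + q * (u * cos x)) with (0 + v * 1 + q * (cos (u * 0 - x) * (u * 1 - 0))).
        2:{ replace (u * 0 - x) with (- x) by ring. rewrite cos_neg. ring. }
        apply (derivable_pt_lim_plus (fun r => q * sin x + v * r)
                 (fun r => q * sin (u * r - x))).
        + apply (derivable_pt_lim_plus (fun _ => q * sin x) (fun r => v * r)).
          * apply derivable_pt_lim_const.
          * apply (derivable_pt_lim_scal (fun r => r)). apply derivable_pt_lim_id.
        + apply (derivable_pt_lim_scal (fun r => sin (u * r - x))).
          apply (derivable_pt_lim_comp (fun r => u * r - x) sin).
          * apply (derivable_pt_lim_minus (fun r => u * r) (fun _ => x)).
            -- apply (derivable_pt_lim_scal (fun r => r)). apply derivable_pt_lim_id.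
            -- apply derivable_pt_lim_const.
          * apply derivable_pt_lim_sin.
      - replace (u * 0 - x) with (- x) by ring. rewrite sin_neg. ring. }
    destruct (Rlt_dec 0 u) as [|Hn]; [assumption | exfalso].
    rewrite (Rabs_left1 u) in Hu by lra.
    assert (s * L <= cos x * - u) by nra.
    assert (q * (s * L) <= q * (cos x * - u)) by (apply Rmult_le_compat_l; lra).
    nra. }
  split; [assumption |].
  rewrite (Rabs_pos_eq u) in Hu by lra.
  (* The time at which the light mass would point vertically downward. *)
  set (r := (3 * (PI / 2) + x) / u).
  assert (Eur : u * r = 3 * (PI / 2) + x) by (unfold r; field; lra).
  assert (Hr : 0 < r) by (apply Rdiv_lt_0_compat; lra).
  assert (HTr : T <= r).
  { destruct (Rle_dec T r) as [|Hn]; [assumption | exfalso].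
    assert (Hh : 0 < q * sin x + v * r + q * sin (u * r - x)) by (apply Hpos; lra).
    replace (u * r - x) with (3 * (PI / 2)) in Hh by lra.
    rewrite sin_3PI2 in Hh.
    assert (v * r * L <= 2 * PI * eta).
    { assert (r * L <= 2 * PI) by nra.
      assert (v * r <= eta * r) by nra.
      assert (v * r * L <= eta * r * L) by nra.
      assert (eta * (r * L) <= eta * (2 * PI)) by nra. nra. }
    assert (Hsq : s ^ 2 / 2 <= 1 - sin x).
    { pose proof (sin2_cos2 x) as E. unfold Rsqr in E. pose proof (SIN_bound x).
      assert (s * s <= cos x * cos x) by nra.
      assert (0 < sin x) by (apply sin_gt_0; lra). nra. }
    assert (v * r < s ^ 2 / 4) by nra. nra. }
  assert (HuT : u * T <= 3 * (PI / 2) + x) by nra.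
  assert (HuT0 : 0 < u * T) by nra.
  assert (Sx' : 0 < sin x') by (apply sin_gt_0; lra).
  (* [u * T - x] lies in [(- x, 3 * PI / 2]] and has negative sine, so it is either on
     the starting side of the vertical or beyond [PI]. *)
  destruct (Rlt_dec (u * T - x) 0) as [Hneg | Hnn].
  - exfalso.
    destruct (MVT_cor2 sin cos (x - u * T) x ltac:(lra)) as [z [E Hz]].
    { intros; apply derivable_pt_lim_sin. }
    replace (x - u * T) with (- (u * T - x)) in E by ring. rewrite sin_neg in E.
    assert (s <= cos z) by (apply Rle_trans with (cos x); [lra | apply cos_decr_1; lra]).
    assert (F : T * (q * (cos z * u)) = T * - v) by nra.
    apply Rmult_eq_reg_l in F; [| lra].
    assert (s * L <= cos z * u) by (apply Rmult_le_compat; lra). nra.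
  - destruct (Rle_dec (u * T - x) PI) as [Hle | Hgt].
    + exfalso. assert (0 <= sin (u * T - x)) by (apply sin_ge_0; lra). lra.
    + assert (E : sin (u * T - x - PI) = sin x').
      { unfold Rminus at 1. rewrite sin_plus, cos_neg, sin_neg, cos_PI, sin_PI. lra. }
      assert (u * T - x - PI = x'); [| lra].
      rewrite <- (asin_sin (u * T - x - PI)), <- (asin_sin x'), E by lra. reflexivity.
Qed.

(** * The collision law for a small mass fraction *)

Lemma reflect_energy : forall p q k v w, p + q * k ^ 2 <> 0 -> p + q = 1 ->
  reflect_y p q k v w ^ 2 + p * q * reflect_phi p q k v w ^ 2
  = v ^ 2 + p * q * w ^ 2.
Proof.
  intros p q k v w HD Hq. unfold reflect_y, reflect_phi.
  field. exact HD.
Qed.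

Lemma Rabs_div_le : forall x d b e, 0 < e -> e <= d -> Rabs x <= b -> Rabs (x / d) <= b / e.
Proof.
  intros x d b e He Hd Hx. unfold Rdiv. rewrite Rabs_mult, (Rabs_pos_eq (/ d)).
  2:{ left. apply Rinv_0_lt_compat. lra. }
  apply Rmult_le_compat; [apply Rabs_pos | left; apply Rinv_0_lt_compat; lra | exact Hx |].
  apply Rinv_le_contravar; lra.
Qed.

(** The change of [v] is exactly [- 2 * d ^ 2 * (v + q * k * w) / D] with
    [q = 1 - d ^ 2] and [D = d ^ 2 + q * k ^ 2 >= k ^ 2]: a light mass transfers little
    momentum to the center of mass. *)
Lemma reflect_y_small_mass : forall B s d k v w,
  0 < d <= 1 -> 0 < s -> s <= Rabs k <= 1 ->
  Rabs v <= B * d -> Rabs w <= B ->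
  Rabs (reflect_y (d ^ 2) (1 - d ^ 2) k v w - v) <= 4 * B / s ^ 2 * d ^ 2.
Proof.
  intros B s d k v w Hd Hs Hk Hv Hw.
  assert (HB : 0 <= B) by (pose proof (Rabs_pos w); lra).
  assert (Hk2 : s ^ 2 <= k ^ 2 <= 1) by (rewrite <- (pow2_abs k); nra).
  assert (Hd2 : 0 < d ^ 2 <= 1) by nra.
  set (D := d ^ 2 + (1 - d ^ 2) * k ^ 2).
  assert (HD : k ^ 2 <= D) by (unfold D; nra).
  assert (0 < s ^ 2) by nra.
  replace (reflect_y (d ^ 2) (1 - d ^ 2) k v w - v)
    with (- (2 * d ^ 2 * (v + (1 - d ^ 2) * k * w)) / D).
  2:{ unfold reflect_y. fold D.
      replace (2 * (1 - d ^ 2) * k ^ 2) with (2 * (D - d ^ 2)) by (unfold D; ring).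
      field. lra. }
  replace (4 * B / s ^ 2 * d ^ 2) with (4 * B * d ^ 2 / s ^ 2) by (field; lra).
  apply Rabs_div_le; [lra | lra |].
  rewrite Rabs_Ropp, Rabs_mult, (Rabs_pos_eq (2 * d ^ 2)) by lra.
  assert (Rabs (v + (1 - d ^ 2) * k * w) <= 2 * B); [| nra].
  eapply Rle_trans; [apply Rabs_triang |].
  rewrite !Rabs_mult, (Rabs_pos_eq (1 - d ^ 2)) by lra.
  pose proof (Rabs_pos w).
  assert (Rabs k * Rabs w <= 1 * B) by (apply Rmult_le_compat; lra).
  assert (0 <= Rabs k * Rabs w) by nra.
  assert (B * d <= B) by nra. nra.
Qed.

(** A light mass reverses its vertical velocity [v + k * w] without changing [v], and
    [v + k * w' = - (v + k * w)] gives [w' = - w - 2 * v / k].  The correction is exactly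
    [2 * d ^ 2 * (w * k + v * (1 - k ^ 2)) / (D * k)], with [D] as above. *)
Lemma reflect_phi_small_mass : forall B s d k v w,
  0 < d <= 1 -> 0 < s -> s <= Rabs k <= 1 ->
  Rabs v <= B * d -> Rabs w <= B ->
  Rabs (reflect_phi (d ^ 2) (1 - d ^ 2) k v w + w + 2 * v / k)
    <= 4 * B / s ^ 3 * d ^ 2.
Proof.
  intros B s d k v w Hd Hs Hk Hv Hw.
  assert (HB : 0 <= B) by (pose proof (Rabs_pos w); lra).
  assert (Hk0 : k <> 0) by (intro E; rewrite E, Rabs_R0 in Hk; lra).
  assert (Hk2 : s ^ 2 <= k ^ 2 <= 1) by (rewrite <- (pow2_abs k); nra).
  assert (Hd2 : 0 < d ^ 2 <= 1) by nra.
  set (D := d ^ 2 + (1 - d ^ 2) * k ^ 2).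
  assert (HD : k ^ 2 <= D) by (unfold D; nra).
  assert (0 < s ^ 2) by nra.
  replace (reflect_phi (d ^ 2) (1 - d ^ 2) k v w + w + 2 * v / k)
    with ((2 * d ^ 2 * (w * k + v * (1 - k ^ 2))) / (D * k)).
  2:{ unfold reflect_phi. fold D.
      replace (2 * (1 - d ^ 2) * k ^ 2) with (2 * (D - d ^ 2)) by (unfold D; ring).
      assert (D <> 0) by lra.
      apply Rmult_eq_reg_r with (D * k); [| now apply Rmult_integral_contrapositive].
      field_simplify; [| split; assumption | split; assumption].
      unfold D; ring. }
  replace (4 * B / s ^ 3 * d ^ 2) with (4 * B * d ^ 2 / s ^ 3) by (field; lra).
  replace (Rabs (2 * d ^ 2 * (w * k + v * (1 - k ^ 2)) / (D * k)))
    with (Rabs (2 * d ^ 2 * (w * k + v * (1 - k ^ 2)) / (D * Rabs k))).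
  2:{ unfold Rdiv. rewrite !(Rabs_mult (_ * _)), !Rabs_inv, !Rabs_mult, Rabs_Rabsolu.
      reflexivity. }
  apply Rabs_div_le; [nra | simpl; nra |].
  rewrite Rabs_mult, (Rabs_pos_eq (2 * d ^ 2)) by lra.
  assert (Rabs (w * k + v * (1 - k ^ 2)) <= 2 * B); [| nra].
  eapply Rle_trans; [apply Rabs_triang |].
  rewrite !Rabs_mult, (Rabs_pos_eq (1 - k ^ 2)) by lra.
  pose proof (Rabs_pos w). pose proof (Rabs_pos v).
  assert (Rabs w * Rabs k <= B * 1) by (apply Rmult_le_compat; lra).
  assert (B * d <= B) by nra.
  assert (Rabs v * (1 - k ^ 2) <= B * 1) by (apply Rmult_le_compat; lra). lra.
Qed.

Lemma reflect_phi_reversal : forall B s d k v w,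
  0 < d <= 1 -> 0 < s -> s <= Rabs k <= 1 ->
  Rabs v <= B * d -> Rabs w <= B ->
  Rabs (reflect_phi (d ^ 2) (1 - d ^ 2) k v w + w) <= 6 * B / s ^ 3 * d.
Proof.
  intros B s d k v w Hd Hs Hk Hv Hw.
  pose proof (reflect_phi_small_mass B s d k v w Hd Hs Hk Hv Hw) as Dw.
  set (w' := reflect_phi (d ^ 2) (1 - d ^ 2) k v w) in *.
  replace (w' + w) with ((w' + w + 2 * v / k) + - (2 * v / k)) by ring.
  eapply Rle_trans; [apply Rabs_triang |]. rewrite Rabs_Ropp.
  assert (Hi : 1 <= / s) by (rewrite <- Rinv_1; apply Rinv_le_contravar; lra).
  assert (Hvk : Rabs (2 * v / k) <= 2 * (B * d) / s).
  { unfold Rdiv at 1. rewrite Rabs_mult, Rabs_inv, Rabs_mult, (Rabs_pos_eq 2) by lra.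
    pose proof (Rabs_pos v).
    apply Rmult_le_compat; [lra | | lra | apply Rinv_le_contravar; lra].
    left. apply Rinv_0_lt_compat. lra. }
  set (X := B * d * / s ^ 3).
  assert (HBd : 0 <= B * d) by (pose proof (Rabs_pos v); lra).
  assert (Hi3 : / s <= / s ^ 3).
  { rewrite <- pow_inv, <- (pow_1 (/ s)) at 1. apply Rle_pow; [exact Hi | lia]. }
  assert (HX : B * d * / s <= X) by (apply Rmult_le_compat_l; assumption).
  assert (HX0 : 0 <= X) by (apply Rle_trans with (B * d * / s); [apply Rmult_le_pos |]; lra).
  assert (HXd : X * d <= X * 1) by (apply Rmult_le_compat_l; lra).
  replace (4 * B / s ^ 3 * d ^ 2) with (4 * (X * d)) in Dw by (unfold X; field; lra).
  replace (6 * B / s ^ 3 * d) with (6 * X) by (unfold X; field; lra).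
  unfold Rdiv in Hvk. lra.
Qed.

Lemma Rabs_le_of_sqr_le : forall x b, 0 <= b -> x ^ 2 <= b ^ 2 -> Rabs x <= b.
Proof.
  intros x b Hb H. rewrite <- pow2_abs in H. pose proof (Rabs_pos x). nra.
Qed.

(** The rotational energy carries a factor [d ^ 2], so the total energy is of order [d ^ 2];
    hence [v] stays of order [d], with no loss from the number of collisions. *)
Lemma velocities_bounded_by_energy : forall A d v0 w0 v w,
  0 <= A -> 0 < d -> d ^ 2 <= 1 / 2 -> Rabs v0 <= d -> Rabs w0 <= A ->
  v ^ 2 + d ^ 2 * (1 - d ^ 2) * w ^ 2 = v0 ^ 2 + d ^ 2 * (1 - d ^ 2) * w0 ^ 2 ->
  Rabs v <= 2 * (1 + A) * d /\ Rabs w <= 2 * (1 + A).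
Proof.
  intros A d v0 w0 v w HA Hd Hd2 Hv0 Hw0 E.
  assert (Hp : 0 < d ^ 2) by (apply pow_lt; lra).
  pose proof (Rabs_pos v0). pose proof (Rabs_pos w0).
  assert (Sv0 : v0 ^ 2 <= d ^ 2) by (rewrite <- pow2_abs; apply pow_incr; lra).
  assert (Sw0 : w0 ^ 2 <= A ^ 2) by (rewrite <- (pow2_abs w0); apply pow_incr; lra).
  pose proof (pow2_ge_0 v). pose proof (pow2_ge_0 w). pose proof (pow2_ge_0 w0).
  set (p := d ^ 2) in *.
  assert (Hq0 : (1 - p) * w0 ^ 2 <= 1 * A ^ 2) by (apply Rmult_le_compat; lra).
  assert (Hq : 1 / 2 * w ^ 2 <= (1 - p) * w ^ 2) by (apply Rmult_le_compat_r; lra).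
  assert (Hup : p * ((1 - p) * w0 ^ 2) <= p * (1 * A ^ 2)) by (apply Rmult_le_compat_l; lra).
  assert (Hlo : 0 <= p * ((1 - p) * w ^ 2)) by (apply Rmult_le_pos; lra).
  assert (HA2 : 1 + A ^ 2 <= (1 + A) ^ 2) by (simpl; lra).
  split; apply Rabs_le_of_sqr_le.
  - apply Rmult_le_pos; lra.
  - replace ((2 * (1 + A) * d) ^ 2) with (p * (4 * (1 + A) ^ 2)) by (unfold p; ring).
    assert (p * (1 + A ^ 2) <= p * (4 * (1 + A) ^ 2))
      by (apply Rmult_le_compat_l; [lra | pose proof (pow2_ge_0 (1 + A)); lra]).
    lra.
  - lra.
  - assert ((1 - p) * w ^ 2 <= 1 + A ^ 2) by (apply Rmult_le_reg_l with p; lra).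
    replace ((2 * (1 + A)) ^ 2) with (4 * (1 + A) ^ 2) by ring.
    pose proof (pow2_ge_0 (1 + A)). lra.
Qed.

(** * Cancellation of the first-order change of the action *)

(** [M * d] bounds the change of the contact angle, [B * M ^ 2] comes from the Taylor
    remainder of the sine, the following two terms from replacing the later
    velocity and contact angle by [v] and [x], and the last one from the collision law. *)
Definition step_constant (s L B : R) : R :=
  let M := 4 * PI * B / (L * s) in
  (B * M ^ 2 + 4 * PI * (4 * B / s ^ 2 + B) + 2 * B * M) / s + PI * (4 * B / s ^ 3).

(** To first order, the contact angle changes by [2 * v * g / (W * cos x)] with
    [g = PI / 2 + x], by the two equations for the flight time [T]; and the angular speed
    changes by [- 2 * v / cos x] at the collision.  The products [W * (x' - x)] and
    [g * (W' - W)] thus cancel up to [O(d ^ 2)]. *)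
Lemma action_step : forall s L B d v v' W W' T x x',
  0 < s -> 0 < L -> 0 < d -> d ^ 2 <= 1 / 2 ->
  0 < x < PI / 2 -> 0 < x' < PI / 2 -> s <= cos x -> s <= cos x' ->
  Rabs v <= B * d -> Rabs v' <= B * d -> L <= W' <= B -> 0 < T ->
  Rabs (v' - v) <= 4 * B / s ^ 2 * d ^ 2 ->
  Rabs (W' - W + 2 * v / cos x) <= 4 * B / s ^ 3 * d ^ 2 ->
  W' * T = PI + x + x' ->
  (1 - d ^ 2) * (sin x' - sin x) = v' * T ->
  Rabs (W' * (PI / 2 + x') - W * (PI / 2 + x)) <= step_constant s L B * d ^ 2.
Proof.
  intros s L B d v v' W W' T x x' Hs HL Hd Hd2 Hx Hx' Cx Cx' Hv Hv' HW HT Hvv HWW ET EY.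
  unfold step_constant. set (M := 4 * PI * B / (L * s)).
  pose proof PI_RGT_0 as HPI. pose proof (COS_bound x) as HC.
  assert (HB : 0 < B) by lra.
  assert (HM : 0 < M) by (unfold M; apply Rdiv_lt_0_compat; nra).
  assert (EM : M * s * L = 4 * PI * B) by (unfold M; field; lra).
  set (q := 1 - d ^ 2) in *. assert (Hq : 1 / 2 <= q <= 1) by (unfold q; nra).
  assert (Hqi : 0 < / q <= 2).
  { split; [apply Rinv_0_lt_compat; lra |].
    replace 2 with (/ (1 / 2)) by field. apply Rinv_le_contravar; lra. }
  assert (HTL : T * L <= 2 * PI) by nra.
  assert (Hang : Rabs (x' - x) <= M * d).
  { pose proof (sin_expanding s x x' ltac:(lra) ltac:(lra) ltac:(lra) Cx Cx') as H.
    assert (H1 : q * Rabs (sin x' - sin x) <= B * d * T).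
    { rewrite <- (Rabs_pos_eq q) at 1 by lra. rewrite <- Rabs_mult, EY, Rabs_mult.
      rewrite (Rabs_pos_eq T) by lra. nra. }
    assert (H2 : s * Rabs (x' - x) <= 2 * (B * d * T)).
    { pose proof (Rabs_pos (sin x' - sin x)). nra. }
    apply Rmult_le_reg_r with (s * L); [nra |].
    replace (M * d * (s * L)) with (4 * PI * B * d) by (rewrite <- EM; ring).
    assert (s * Rabs (x' - x) * L <= 2 * (B * d * T) * L) by (apply Rmult_le_compat_r; lra).
    assert (B * d * (T * L) <= B * d * (2 * PI)) by (apply Rmult_le_compat_l; nra).
    lra. }
  pose proof (Rabs_pos (x' - x)) as Hap.
  assert (Htay : Rabs (W' * (sin x' - sin x - cos x * (x' - x))) <= B * M ^ 2 * d ^ 2).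
  { rewrite Rabs_mult, (Rabs_pos_eq W') by lra.
    pose proof (sin_taylor x x') as H.
    assert (Rabs (x' - x) ^ 2 <= (M * d) ^ 2) by (apply pow_incr; lra).
    replace (B * M ^ 2 * d ^ 2) with (B * (M * d) ^ 2) by ring.
    apply Rmult_le_compat; [lra | apply Rabs_pos | lra | lra]. }
  set (g := PI / 2 + x).
  assert (Hg : 0 < g <= PI) by (unfold g; lra).
  assert (Hchord : Rabs (W' * (sin x' - sin x) - 2 * g * v)
                   <= (4 * PI * (4 * B / s ^ 2 + B) + 2 * B * M) * d ^ 2).
  { replace (W' * (sin x' - sin x) - 2 * g * v)
      with (2 * g * ((v' - v) + d ^ 2 * v) * / q + v' * (x' - x) * / q).
    2:{ replace (sin x' - sin x) with (v' * T * / q) by (rewrite <- EY; field; lra).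
        replace (W' * (v' * T * / q)) with (v' * / q * (W' * T)) by ring. rewrite ET.
        replace (d ^ 2) with (1 - q) by (unfold q; ring). unfold g. field. lra. }
    assert (H1 : Rabs ((v' - v) + d ^ 2 * v) <= (4 * B / s ^ 2 + B) * d ^ 2).
    { eapply Rle_trans; [apply Rabs_triang |].
      rewrite Rabs_mult, (Rabs_pos_eq (d ^ 2)) by nra.
      assert (d <= 1) by nra. assert (B * d <= B) by nra.
      assert (d ^ 2 * Rabs v <= d ^ 2 * B) by (apply Rmult_le_compat_l; nra). lra. }
    assert (H2 : Rabs (v' * (x' - x)) <= B * M * d ^ 2).
    { rewrite Rabs_mult. replace (B * M * d ^ 2) with (B * d * (M * d)) by ring.
      apply Rmult_le_compat; auto using Rabs_pos. }
    eapply Rle_trans; [apply Rabs_triang |].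
    rewrite (Rabs_mult _ (/ q)), (Rabs_mult (v' * _) (/ q)), (Rabs_mult (2 * g)).
    rewrite (Rabs_pos_eq (/ q)), (Rabs_pos_eq (2 * g)) by lra.
    set (X := Rabs (v' - v + d ^ 2 * v)) in *. set (Y := Rabs (v' * (x' - x))) in *.
    assert (0 <= X) by apply Rabs_pos. assert (0 <= Y) by apply Rabs_pos.
    assert (2 * g * X <= 2 * PI * ((4 * B / s ^ 2 + B) * d ^ 2))
      by (apply Rmult_le_compat; lra).
    assert (2 * g * X * / q <= 2 * PI * ((4 * B / s ^ 2 + B) * d ^ 2) * 2)
      by (apply Rmult_le_compat; nra).
    assert (Y * / q <= B * M * d ^ 2 * 2) by (apply Rmult_le_compat; lra). lra. }
  replace (W' * (PI / 2 + x') - W * g)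
    with ((W' * (sin x' - sin x) - 2 * g * v
           - W' * (sin x' - sin x - cos x * (x' - x))) / cos x
          + g * (W' - W + 2 * v / cos x)) by (unfold g; field; lra).
  eapply Rle_trans; [apply Rabs_triang |].
  rewrite Rmult_plus_distr_r. apply Rplus_le_compat.
  - replace ((B * M ^ 2 + 4 * PI * (4 * B / s ^ 2 + B) + 2 * B * M) / s * d ^ 2)
      with ((B * M ^ 2 + 4 * PI * (4 * B / s ^ 2 + B) + 2 * B * M) * d ^ 2 / s)
      by (field; lra).
    apply Rabs_div_le; [lra | lra |].
    eapply Rle_trans; [apply Rabs_triang |]. rewrite Rabs_Ropp. lra.
  - rewrite Rabs_mult, (Rabs_pos_eq g), Rmult_assoc by lra.
    apply Rmult_le_compat; [lra | apply Rabs_pos | lra | exact HWW].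
Qed.

(** * Contact angles *)

Lemma asin_increasing : forall x y, -1 <= x -> x < y -> y <= 1 -> asin x < asin y.
Proof.
  intros x y Hx Hxy Hy. pose proof (asin_bound x). pose proof (asin_bound y).
  apply sin_increasing_0; try lra. rewrite !sin_asin; lra.
Qed.

(** The angle between the rod and the floor, the same on both sides of the vertical.  With
    the light mass on the floor, the height of the center of mass is
    [beta2 * sin (contact_angle phi)]. *)
Definition contact_angle (phi : R) : R := asin (- sin phi).

Lemma contact_angle_spec : forall phi, sin phi < 0 -> cos phi <> 0 ->
  0 < contact_angle phi < PI / 2 /\ sin (contact_angle phi) = - sin phi /\
  cos (contact_angle phi) = Rabs (cos phi).
Proof.
  intros phi Hs Hc. pose proof (sin2_cos2 phi) as E. unfold Rsqr in E.
  assert (0 < cos phi * cos phi) by nra.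
  unfold contact_angle. assert (- sin phi < 1) by nra.
  split; [split |split].
  - rewrite <- asin_0. apply asin_increasing; lra.
  - rewrite <- asin_1. apply asin_increasing; lra.
  - apply sin_asin. lra.
  - rewrite cos_asin by lra. rewrite <- sqrt_Rsqr_abs. f_equal. unfold Rsqr. nra.
Qed.

Lemma sin_cos_period_Z : forall x (k : Z),
  sin (x + 2 * PI * IZR k) = sin x /\ cos (x + 2 * PI * IZR k) = cos x.
Proof.
  assert (H : forall x n, sin (x + 2 * PI * INR n) = sin x
                          /\ cos (x + 2 * PI * INR n) = cos x).
  { intros x n. replace (x + 2 * PI * INR n) with (x + 2 * INR n * PI) by ring.
    split; [apply sin_period | apply cos_period]. }
  intros x k. destruct (Z_le_gt_dec 0 k) as [Hk | Hk].
  - rewrite <- (Z2Nat.id k), <- INR_IZR_INZ by lia. apply H.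
  - destruct (H (x + 2 * PI * IZR k) (Z.to_nat (- k))) as [Es Ec].
    rewrite INR_IZR_INZ, Z2Nat.id, opp_IZR in Es, Ec by lia.
    rewrite <- Es, <- Ec. split; f_equal; ring.
Qed.

(** Subtracting the multiple of [2 * PI] nearest to [phi - 3 * PI / 2] leaves an angle [z]
    with [|z| <= PI], and then [sin phi = - cos z] and [|cos phi| = |sin z|]. *)
Lemma cos_ge_away_from_bottom : forall c phi,
  0 < c -> sin phi < 0 ->
  (forall k : Z, c <= Rabs (phi - (3 * PI / 2 + 2 * PI * IZR k))) ->
  sin (Rmin c (PI / 2)) <= Rabs (cos phi).
Proof.
  intros c phi Hc Hs Haway. pose proof PI_RGT_0 as HPI.
  set (r := (phi - 3 * PI / 2) / (2 * PI) - 1 / 2).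
  set (k := up r). destruct (archimed r) as [K1 K2]. fold k in K1, K2.
  specialize (Haway k).
  set (z := phi - (3 * PI / 2 + 2 * PI * IZR k)) in *.
  assert (Er : 2 * PI * r = phi - 3 * PI / 2 - PI) by (unfold r; field; lra).
  assert (Hz : - PI <= z <= PI) by (unfold z; split; nra).
  assert (Ephi : phi = (z + 3 * (PI / 2)) + 2 * PI * IZR k) by (unfold z; field).
  destruct (sin_cos_period_Z (z + 3 * (PI / 2)) k) as [Es Ec].
  rewrite <- Ephi, sin_plus, sin_3PI2, cos_3PI2 in Es.
  rewrite <- Ephi, cos_plus, sin_3PI2, cos_3PI2 in Ec.
  assert (Hz0 : 0 <= Rabs z <= PI) by (split; [apply Rabs_pos | apply Rabs_le; lra]).
  assert (Cz : cos (Rabs z) = cos z)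
    by (unfold Rabs; destruct Rcase_abs; rewrite ?cos_neg; reflexivity).
  assert (Sz : sin (Rabs z) <= Rabs (sin z)).
  { unfold Rabs at 1. destruct Rcase_abs; rewrite ?sin_neg.
    - rewrite <- Rabs_Ropp. apply Rle_abs.
    - apply Rle_abs. }
  assert (Hzlt : Rabs z < PI / 2).
  { destruct (Rlt_dec (Rabs z) (PI / 2)) as [|Hn]; [assumption | exfalso].
    assert (cos (Rabs z) <= 0) by (apply cos_le_0; lra). lra. }
  replace (cos phi) with (sin z) by lra.
  apply Rle_trans with (sin (Rabs z)); [| exact Sz].
  assert (0 < Rmin c (PI / 2)) by (apply Rmin_pos; lra).
  pose proof (Rmin_l c (PI / 2)). apply sin_incr_1; lra.
Qed.

(** * Drift of the action over one collision *)

(** The action with [f y] replaced by half of the angle that the light mass would sweep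
    above the floor around a center of mass at rest. *)
Definition contact_action (phi w : R) : R := Rabs w * (PI / 2 + contact_angle phi).

Lemma contact_action_bounds : forall phi w, sin phi < 0 -> cos phi <> 0 ->
  Rabs w * (PI / 2) <= contact_action phi w <= Rabs w * PI.
Proof.
  intros phi w Hs Hc. destruct (contact_angle_spec phi Hs Hc) as [Hx _].
  unfold contact_action.
  split; apply Rmult_le_compat_l; try apply Rabs_pos; lra.
Qed.

(** Both sides of the vertical reduce to the same flight by a reflection.  The lower
    bound [2 * L] on [|w|] leaves [|w'| >= L], because the collision reverses [w] up to [L];
    the sign of [w'] is then known from the flight, and with it that of [w]. *)
Lemma contact_action_drift : forall s L B d v w phi v' w' phi' T,
  0 < s <= 1 -> 0 < L -> 0 < d -> d ^ 2 <= 1 / 2 ->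
  8 * PI * (B * d) < s ^ 2 * L -> 6 * B / s ^ 3 * d <= L ->
  sin phi < 0 -> sin phi' < 0 -> s <= Rabs (cos phi) -> s <= Rabs (cos phi') ->
  Rabs v <= B * d -> Rabs v' <= B * d -> 2 * L <= Rabs w <= B -> Rabs w' <= B ->
  v' = reflect_y (d ^ 2) (1 - d ^ 2) (cos phi) v w ->
  w' = reflect_phi (d ^ 2) (1 - d ^ 2) (cos phi) v w ->
  0 < T -> phi' = phi + w' * T ->
  (forall r, 0 < r < T ->
     0 < - (1 - d ^ 2) * sin phi + v' * r + (1 - d ^ 2) * sin (phi + w' * r)) ->
  - (1 - d ^ 2) * sin phi + v' * T + (1 - d ^ 2) * sin phi' = 0 ->
  Rabs (contact_action phi' w' - contact_action phi w) <= step_constant s L B * d ^ 2.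
Proof.
  intros s L B d v w phi v' w' phi' T Hs HL Hd Hd2 Hsmall1 Hsmall2 Sphi Sphi' Cphi Cphi'
    Hv Hv' Hw Hw' Ev Ew HT Ephi Hpos Hend.
  assert (Hc0 : cos phi <> 0) by (intro E; rewrite E, Rabs_R0 in Cphi; lra).
  assert (Hc0' : cos phi' <> 0) by (intro E; rewrite E, Rabs_R0 in Cphi'; lra).
  destruct (contact_angle_spec phi Sphi Hc0) as [Hx [Sx Cx]].
  destruct (contact_angle_spec phi' Sphi' Hc0') as [Hx' [Sx' Cx']].
  unfold contact_action. set (x := contact_angle phi) in *.
  set (x' := contact_angle phi') in *.
  assert (Hd1 : d <= 1) by nra. assert (Hdsq : 0 < d ^ 2) by nra. assert (HB : 0 < B) by lra.
  assert (Hk1 : Rabs (cos phi) <= 1) by (apply Rabs_le; apply COS_bound).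
  pose proof (reflect_y_small_mass B s d (cos phi) v w ltac:(lra) ltac:(lra) ltac:(lra)
                Hv ltac:(lra)) as Dv.
  pose proof (reflect_phi_small_mass B s d (cos phi) v w ltac:(lra) ltac:(lra) ltac:(lra)
                Hv ltac:(lra)) as Dw.
  rewrite <- Ev in Dv. rewrite <- Ew in Dw.
  assert (Hback : Rabs (w' + w) <= L).
  { rewrite Ew. apply Rle_trans with (6 * B / s ^ 3 * d); [| exact Hsmall2].
    apply reflect_phi_reversal; lra. }
  (* The sign of the cosine tells on which side of the vertical the contact lies; it turns
     the rotation after the contact into one in the positive sense. *)
  assert (Hsg : exists sg, (sg = 1 \/ sg = -1) /\ cos phi = sg * cos x).
  { rewrite Cx. unfold Rabs. destruct Rcase_abs; [exists (-1) | exists 1]; split; auto; ring. }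
  destruct Hsg as [sg [Hsg Ecos]].
  assert (Hsin : forall r, sin (sg * w' * r - x) = sin (phi + w' * r)).
  { intro r. rewrite sin_minus, sin_plus, Sx, Ecos.
    destruct Hsg as [-> | ->].
    - rewrite !Rmult_1_l. ring.
    - replace (-1 * w' * r) with (- (w' * r)) by ring. rewrite sin_neg, cos_neg. ring. }
  assert (Habs : forall r, Rabs (sg * r) = Rabs r).
  { intro r. rewrite Rabs_mult.
    destruct Hsg as [-> | ->]; [rewrite Rabs_R1 | rewrite Rabs_left by lra]; ring. }
  assert (HLw : L <= Rabs w').
  { pose proof (Rabs_triang (w' + w) (- w')) as H. rewrite Rabs_Ropp in H.
    replace (w' + w + - w') with w in H by ring. lra. }
  assert (Hturn : 0 < sg * w' /\ sg * w' * T = PI + x + x').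
  { apply turn_of_flight with (s := s) (L := L) (eta := B * d) (q := 1 - d ^ 2) (v := v');
      try lra.
    - rewrite Habs. exact HLw.
    - intros r Hr. rewrite Hsin, Sx. specialize (Hpos r Hr). lra.
    - rewrite Hsin, Sx, <- Ephi. lra.
    - rewrite Hsin, Sx', <- Ephi. lra. }
  destruct Hturn as [Hu HuT].
  assert (EW' : Rabs w' = sg * w') by (rewrite <- Habs; apply Rabs_pos_eq; lra).
  assert (EW : Rabs w = - (sg * w)).
  { rewrite <- Habs. apply Rabs_left1.
    rewrite <- (Habs (w' + w)), Rmult_plus_distr_l in Hback.
    pose proof (Rle_abs (sg * w' + sg * w)). lra. }
  apply action_step with (v := v) (v' := v') (T := T); try lra.
  - rewrite EW', EW.
    replace (sg * w' - - (sg * w) + 2 * v / cos x)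
      with (sg * (w' + w + 2 * v / cos phi)).
    { rewrite Habs. exact Dw. }
    rewrite Ecos. assert (cos x <> 0) by lra.
    destruct Hsg as [-> | ->]; field; lra.
  - rewrite EW'. exact HuT.
  - rewrite Sx, Sx'. lra.
Qed.

(** The action uses [asin (q * sin x)] with [q = 1 - d ^ 2] in place of [x]; away from the
    vertical, these angles are as close as their sines. *)
Lemma contact_action_close : forall s B d phi w,
  0 < s -> 0 < d -> d ^ 2 <= 1 / 2 -> sin phi < 0 -> s <= Rabs (cos phi) -> Rabs w <= B ->
  Rabs (action (- (1 - d ^ 2) * sin phi) w - contact_action phi w) <= B / s * d ^ 2.
Proof.
  intros s B d phi w Hs Hd Hd2 Sphi Cphi Hw.
  assert (Hc0 : cos phi <> 0) by (intro E; rewrite E, Rabs_R0 in Cphi; lra).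
  destruct (contact_angle_spec phi Sphi Hc0) as [Hx [Sx Cx]].
  unfold action, contact_action, Defs.f. set (x := contact_angle phi) in *.
  replace (- (1 - d ^ 2) * sin phi) with ((1 - d ^ 2) * sin x) by (rewrite Sx; ring).
  pose proof (SIN_bound x) as HS.
  assert (S0 : 0 < sin x) by lra.
  assert (Hd3 : 0 < d ^ 2) by nra.
  set (y := (1 - d ^ 2) * sin x). assert (Hy : 0 <= y <= sin x) by (unfold y; nra).
  rewrite acos_asin by lra.
  set (z := asin y).
  assert (Ex : asin (sin x) = x) by (apply asin_sin; lra).
  assert (Hzx : z <= x).
  { destruct (Req_dec y (sin x)) as [E | E].
    - unfold z. rewrite E, Ex. lra.
    - rewrite <- Ex. left. apply asin_increasing; lra. }
  assert (Hz0 : 0 <= z).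
  { destruct (Req_dec y 0) as [E | E].
    - unfold z. rewrite E, asin_0. lra.
    - rewrite <- asin_0. left. apply asin_increasing; lra. }
  assert (Sz : sin z = y) by (apply sin_asin; lra).
  assert (Cz : s <= cos z) by (apply Rle_trans with (cos x); [lra | apply cos_decr_1; lra]).
  pose proof (sin_expanding s x z ltac:(lra) ltac:(lra) ltac:(lra) ltac:(lra) Cz) as H.
  rewrite Sz in H.
  assert (Rabs (y - sin x) <= d ^ 2) by (apply Rabs_le; unfold y; split; nra).
  assert (Hzd : Rabs (z - x) <= d ^ 2 / s).
  { apply Rmult_le_reg_l with s; [lra |].
    replace (s * (d ^ 2 / s)) with (d ^ 2) by (field; lra).
    lra. }
  replace (Rabs w * (PI - (PI / 2 - z)) - Rabs w * (PI / 2 + x))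
    with (Rabs w * (z - x)) by field.
  rewrite Rabs_mult, Rabs_Rabsolu.
  replace (B / s * d ^ 2) with (B * (d ^ 2 / s)) by (field; lra).
  apply Rmult_le_compat; auto using Rabs_pos.
Qed.

Lemma step_constant_ge_0 : forall s L B, 0 < s -> 0 < L -> 0 < B -> 0 <= step_constant s L B.
Proof.
  intros s L B Hs HL HB. unfold step_constant. pose proof PI_RGT_0.
  assert (0 < 4 * PI * B / (L * s)) by (apply Rdiv_lt_0_compat; nra).
  set (M := 4 * PI * B / (L * s)) in *.
  assert (0 < 4 * B / s ^ 2)
    by (apply Rdiv_lt_0_compat; [lra | apply pow_lt; lra]).
  assert (0 < 4 * B / s ^ 3)
    by (apply Rdiv_lt_0_compat; [lra | apply pow_lt; lra]).
  assert (0 < (B * M ^ 2 + 4 * PI * (4 * B / s ^ 2 + B) + 2 * B * M) / s).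
  { apply Rdiv_lt_0_compat; [| lra].
    assert (0 < M ^ 2) by nra.
    assert (0 < B * M ^ 2) by nra.
    assert (0 < B * M) by nra.
    assert (0 < PI * (4 * B / s ^ 2 + B)) by (apply Rmult_lt_0_compat; lra). lra. }
  assert (0 < PI * (4 * B / s ^ 3)) by (apply Rmult_lt_0_compat; lra). lra.
Qed.

(** * Adiabatic invariance *)

Theorem theorem3p3 :
  forall a A c K : R, 0 < a -> a <= A -> 0 < c -> 0 < K ->
  exists delta0 C : R, 0 < delta0 /\ 0 < C /\
  forall (delta m1 m2 : R) (y phi : R -> R) (N : nat)
         (hit : nat -> mass) (t vy vphi : nat -> R),
    0 < delta < delta0 ->
    0 < m1 -> 0 < m2 -> beta1 m1 m2 = delta ^ 2 ->
    consecutive_collisions m1 m2 y phi N hit t vy vphi ->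
    INR N <= K / delta ->
    (forall n, (n <= N)%nat -> hit n = Mass1) ->
    a <= Rabs (vphi 0%nat) <= A ->
    (forall n, (n <= N)%nat -> forall k : Z,
       c <= Rabs (phi (t n) - (3 * PI / 2 + 2 * PI * IZR k))) ->
    - delta < vy 0%nat < 0 ->
    Rabs (action (y (t N)) (vphi N) - action (y (t 0%nat)) (vphi 0%nat))
      <= C * delta.
Proof.
  intros a A c K Ha HaA Hc HK. pose proof PI2_3_2 as HPI.
  set (s := sin (Rmin c (PI / 2))).
  assert (Hs : 0 < s <= 1).
  { assert (0 < Rmin c (PI / 2)) by (apply Rmin_pos; lra).
    pose proof (Rmin_r c (PI / 2)).
    split; [apply sin_gt_0; lra | apply SIN_bound]. }
  (* [B] is the velocity bound of [velocities_bounded_by_energy], and [2 * L = a / 4] is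
     the lower bound on [|w|] maintained along the induction. *)
  set (B := 2 * (1 + A)). assert (HB : 0 < B) by (unfold B; lra).
  set (L := a / 8). assert (HL : 0 < L) by (unfold L; lra).
  set (M := step_constant s L B).
  assert (HS : 0 <= M) by (apply step_constant_ge_0; lra).
  assert (Hs2 : 0 < s ^ 2) by (apply pow_lt; lra).
  assert (Hs3 : 0 < s ^ 3) by (apply pow_lt; lra).
  (* The first two thresholds are those of [contact_action_drift]; the third keeps the
     total drift below [a / 2], which is what preserves the lower bound on [|w|]. *)
  set (d1 := s ^ 2 * L / (8 * PI * B)).
  set (d2 := L * s ^ 3 / (6 * B)).
  set (d3 := a / 2 / (K * M + 1)).
  assert (Hd1 : 0 < d1)
    by (apply Rdiv_lt_0_compat; apply Rmult_lt_0_compat; lra).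
  assert (Hd2 : 0 < d2)
    by (apply Rdiv_lt_0_compat; [apply Rmult_lt_0_compat |]; lra).
  assert (HKS : 0 <= K * M) by nra.
  assert (Hd3 : 0 < d3) by (apply Rdiv_lt_0_compat; lra).
  exists (Rmin (1 / 2) (Rmin d1 (Rmin d2 d3))), (K * M + 2 * (B / s)).
  assert (HBs : 0 < B / s) by (apply Rdiv_lt_0_compat; lra).
  split; [repeat apply Rmin_pos; lra | split; [lra |]].
  intros d m1 m2 y phi N hit t v w Hd Hm1 Hm2 Hb [_ [Hcol Hfly]] HN Hhit Hw0 Haway Hv0.
  pose proof (Rmin_l (1 / 2) (Rmin d1 (Rmin d2 d3))).
  pose proof (Rmin_r (1 / 2) (Rmin d1 (Rmin d2 d3))).
  pose proof (Rmin_l d1 (Rmin d2 d3)). pose proof (Rmin_r d1 (Rmin d2 d3)).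
  pose proof (Rmin_l d2 d3). pose proof (Rmin_r d2 d3).
  assert (Hsm1 : 8 * PI * (B * d) < s ^ 2 * L).
  { replace (s ^ 2 * L) with (8 * PI * (B * d1)) by (unfold d1; field; lra).
    apply Rmult_lt_compat_l; [lra |]. apply Rmult_lt_compat_l; lra. }
  assert (Hsm2 : 6 * B / s ^ 3 * d <= L).
  { replace L with (6 * B / s ^ 3 * d2) by (unfold d2; field; lra).
    apply Rmult_le_compat_l; [left; apply Rdiv_lt_0_compat; lra | lra]. }
  assert (Hsm3 : K * M * d <= a / 2).
  { replace (a / 2) with ((K * M + 1) * d3) by (unfold d3; field; lra).
    apply Rmult_le_compat; lra. }
  assert (Hdd : 0 < d ^ 2 <= 1 / 2) by nra.
  assert (Hb2 : beta2 m1 m2 = 1 - d ^ 2)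
    by (rewrite <- Hb; unfold beta1, beta2; field; lra).
  assert (Hcontact : forall n, (n <= N)%nat ->
    y (t n) = - (1 - d ^ 2) * sin (phi (t n)) /\ sin (phi (t n)) < 0
    /\ s <= Rabs (cos (phi (t n)))).
  { intros n Hn. destruct (Hcol n Hn) as [Hown Hother]. rewrite (Hhit n Hn) in Hown, Hother.
    simpl in Hown, Hother. rewrite Hb2 in Hown. rewrite Hb in Hother.
    assert (sin (phi (t n)) < 0) by nra.
    split; [lra | split; [assumption |]].
    apply cos_ge_away_from_bottom; auto. }
  assert (Hstep : forall n, (n < N)%nat ->
    v (S n) = reflect_y (d ^ 2) (1 - d ^ 2) (cos (phi (t n))) (v n) (w n) /\
    w (S n) = reflect_phi (d ^ 2) (1 - d ^ 2) (cos (phi (t n))) (v n) (w n)).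
  { intros n Hn. destruct (Hfly n Hn) as [_ [E1 E2]].
    rewrite (Hhit n) in E1, E2 by lia. simpl in E1, E2. rewrite Hb, Hb2 in E1, E2. auto. }
  assert (Henergy : forall n, (n <= N)%nat ->
    v n ^ 2 + d ^ 2 * (1 - d ^ 2) * w n ^ 2
    = v 0%nat ^ 2 + d ^ 2 * (1 - d ^ 2) * w 0%nat ^ 2).
  { induction n as [|n IH]; intros Hn; [reflexivity |].
    destruct (Hstep n) as [-> ->]; [lia |]. rewrite <- IH by lia.
    apply reflect_energy; [| ring].
    pose proof (pow2_ge_0 (cos (phi (t n)))). nra. }
  assert (Hbound : forall n, (n <= N)%nat -> Rabs (v n) <= B * d /\ Rabs (w n) <= B).
  { intros n Hn. apply velocities_bounded_by_energy with (v0 := v 0%nat) (w0 := w 0%nat);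
      auto; try lra.
    apply Rabs_le. lra. }
  set (J := fun n => contact_action (phi (t n)) (w n)).
  assert (HNd : INR N * d <= K).
  { replace K with (K / d * d) by (field; lra). apply Rmult_le_compat_r; lra. }
  assert (Htotal : INR N * (M * d ^ 2) <= K * M * d).
  { replace (INR N * (M * d ^ 2)) with (INR N * d * (M * d)) by ring.
    rewrite (Rmult_assoc K). apply Rmult_le_compat_r; [apply Rmult_le_pos |]; lra. }
  assert (Hdrift : forall n, (n <= N)%nat -> Rabs (J n - J 0%nat) <= INR n * (M * d ^ 2)).
  { induction n as [|n IH]; intros Hn.
    - simpl. rewrite Rminus_diag, Rabs_R0. lra.
    - specialize (IH ltac:(lia)).
      destruct (Hcontact n) as [Yn [Sn Cn]]; [lia |].
      destruct (Hcontact (S n)) as [Yn' [Sn' Cn']]; [lia |].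
      destruct (Hbound n) as [Vn Wn]; [lia |].
      destruct (Hbound (S n)) as [Vn' Wn']; [lia |].
      destruct (Hstep n) as [Ev Ew]; [lia |].
      destruct (Hfly n) as [[Ht [Hmove Hpos]] _]; [lia |].
      (* The action is at least [a * PI / 2] initially and has lost at most [a / 2]. *)
      assert (Hlow : 2 * L <= Rabs (w n)).
      { assert (Hn1 : INR n * (M * d ^ 2) <= a / 2).
        { apply Rle_trans with (INR N * (M * d ^ 2)); [| lra].
          apply Rmult_le_compat_r; [apply Rmult_le_pos; lra | apply le_INR; lia]. }
        destruct (Hcontact 0%nat) as [_ [Sin0 Cos0]]; [lia |].
        destruct (contact_action_bounds (phi (t 0%nat)) (w 0%nat) Sin0) as [HJ0 _].
        { intro E; rewrite E, Rabs_R0 in Cos0; lra. }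
        destruct (contact_action_bounds (phi (t n)) (w n) Sn) as [_ HJn].
        { intro E; rewrite E, Rabs_R0 in Cn; lra. }
        fold (J 0%nat) in HJ0. fold (J n) in HJn.
        assert (a * (PI / 2) <= Rabs (w 0%nat) * (PI / 2)) by (apply Rmult_le_compat_r; lra).
        assert (a * (3 / 2) <= a * (PI / 2)) by (apply Rmult_le_compat_l; lra).
        assert (Rabs (w n) * PI <= Rabs (w n) * 4)
          by (apply Rmult_le_compat_l; [apply Rabs_pos | pose proof PI_4; lra]).
        pose proof (Rle_abs (J 0%nat - J n)) as HJd. rewrite Rabs_minus_sym in HJd.
        unfold L. lra. }
      assert (Hone : Rabs (J (S n) - J n) <= M * d ^ 2).
      { destruct (Hmove (t (S n))) as [My Mphi]; [lra |].
        apply contact_action_drift with (v := v n) (v' := v (S n))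
          (T := t (S n) - t n); auto; try lra.
        intros r Hr. destruct (Hmove (t n + r)) as [Ry Rphi]; [lra |].
        specialize (Hpos (t n + r) Mass1 ltac:(lra)). simpl in Hpos.
        rewrite Ry, Rphi, Hb2, Yn in Hpos.
        replace (t n + r - t n) with r in Hpos by ring. lra. }
      rewrite S_INR.
      replace (J (S n) - J 0%nat)
        with ((J (S n) - J n) + (J n - J 0%nat)) by ring.
      eapply Rle_trans; [apply Rabs_triang |]. lra. }
  assert (Hclose : forall n, (n <= N)%nat ->
    Rabs (action (y (t n)) (w n) - J n) <= B / s * d).
  { intros n Hn. destruct (Hcontact n Hn) as [-> [Sn Cn]].
    apply Rle_trans with (B / s * d ^ 2).
    - apply contact_action_close; try lra. now apply Hbound.
    - apply Rmult_le_compat_l; nra. }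
  pose proof (Hdrift N ltac:(lia)) as HN1.
  pose proof (Hclose N ltac:(lia)) as HN2.
  pose proof (Hclose 0%nat ltac:(lia)) as HN3.
  replace (action (y (t N)) (w N) - action (y (t 0%nat)) (w 0%nat))
    with ((action (y (t N)) (w N) - J N) + (J N - J 0%nat)
          + - (action (y (t 0%nat)) (w 0%nat) - J 0%nat)) by ring.
  eapply Rle_trans; [apply Rabs_triang |]. rewrite Rabs_Ropp.
  pose proof (Rabs_triang (action (y (t N)) (w N) - J N) (J N - J 0%nat)). lra.
Qed.
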